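(* Let $\alpha,\beta\in\mathbb R$ with $\alpha\ne\beta$, let $R_1,R_2>0$, and let $R_{\min}=\min(R_1,R_2)$. For the Gaussian primitive diamond channel with perfectly correlated noises at the relays, with gains $\alpha,\beta$ and relay-link capacities $R_1,R_2$, and for any power $P>0$, there exists a $(\lfloor 2^{R_{\min}}\rfloor,1)$ code (a code with $\lfloor 2^{R_{\min}}\rfloor$ messages and blocklength $1$) satisfying the average power constraint $P$ and having zero error probability.
   Context: Gaussian primitive diamond channel with perfectly correlated noises: in each channel use, given the input $X\in\mathbb R$, relay 1 observes $Y_1=\alpha X+Z$ and relay 2 observes $Y_2=\beta X+Z$, with the same noise $Z\sim\mathcal N(0,1)$, i.i.d. across channel uses and independent of the message. Relay $j\in\{1,2\}$ has a noiseless link of capacity $R_j$ bits per channel use to a central receiver, which has no direct observation of the channel. A code with $N$ messages and blocklength $n$ (an $(N,n)$ code) consists of an encoder $m\mapsto x^n(m)\in\mathbb R^n$, $m\in\{0,\dots,N-1\}$, with $\frac1n\|x^n(m)\|^2\le P$ for every $m$; relay functions mapping $Y_j^n$ to a message $V_j$ in a set of size at most $2^{nR_j}$, $j=1,2$; and a decoder mapping $(V_1,V_2)$ to $\hat M\in\{0,\dots,N-1\}$. The error probability is $\Pr\{\hat M\ne M\}$ with $M$ uniform on the message set. *)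

(* Defs.v *)
From HB Require Import structures.
From mathcomp Require Import all_boot all_order all_algebra.
From mathcomp Require Import all_classical all_reals all_analysis.

Set Implicit Arguments.
Unset Strict Implicit.
Unset Printing Implicit Defensive.

Import Order.TTheory GRing.Theory Num.Theory.

Local Open Scope classical_set_scope.
Local Open Scope ring_scope.

Section iid.
Context d (T : measurableType d) (R : realType).

Definition tcons n (x : T * n.-tuple T) : n.+1.-tuple T :=
  [tuple of x.1 :: x.2].

Lemma measurable_tcons n : measurable_fun [set: T * n.-tuple T] (@tcons n).
Proof. exact: (measurable_cons measurable_fst measurable_snd). Qed.

HB.instance Definition _ n :=
  isMeasurableFun.Build _ _ _ _ (@tcons n) (@measurable_tcons n).

(* The library has no n-fold product measure: [iid mu n] is the law of n
   independent draws from mu, built one coordinate at a time. *)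
Fixpoint iid (mu : probability T R) (n : nat) : probability (n.-tuple T) R :=
  match n with
  | 0 => \d_([tuple] : 0.-tuple T)
  | n'.+1 => distribution (mu \x iid mu n')%E (@tcons n')
  end.

Lemma iid_box (mu : probability T R) n (A : 'I_n -> set T) :
  (forall i, measurable (A i)) ->
  iid mu n [set t | forall i, A i (tnth t i)] = (\prod_(i < n) mu (A i))%E.
Proof.
elim: n A => [|n IHn] A mA.
  by rewrite big_ord0 /= diracE mem_set// => -[].
rewrite big_ord_recl -IHn// /= /distribution /pushforward.
pose B := [set t : n.-tuple T | forall i, A (lift ord0 i) (tnth t i)].
have mB : measurable B.
  rewrite (_ : B = \bigcap_(i in [set: 'I_n])
      ((@tnth n T ^~ i) @^-1` A (lift ord0 i))); last first.
    by apply/seteqP; split=> t /= Bt i; [move=> _|]; exact: Bt.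
  apply: fin_bigcap_measurable => // i _.
  by rewrite -[X in measurable X]setTI; exact: measurable_tnth.
rewrite -product_measure1E//; congr (_ _).
apply/seteqP; split=> [[x t] /= xtA|[x t] /= [Ax At] i].
- by split=> [|i]; [have := xtA ord0|have := xtA (lift ord0 i)];
    rewrite ?tnthS ?tnth0.
- by have [j ->|->] := unliftP ord0 i; rewrite ?tnthS ?tnth0//; exact: At.
Qed.

End iid.

Section diamond.
Context (R : realType).

(* A relay alphabet of size L is encoded as 'I_L. Relay maps are Borel
   measurable, so that the error event below is measurable. *)
Record diamond_code (R1 R2 : R) (N n : nat) := DiamondCode {
  size1 : nat;
  size2 : nat;
  size1_le : size1%:R <= 2 `^ (n%:R * R1);
  size2_le : size2%:R <= 2 `^ (n%:R * R2);
  encoder : 'I_N -> n.-tuple R;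
  relay1 : n.-tuple (measurableTypeR R) -> 'I_size1;
  relay2 : n.-tuple (measurableTypeR R) -> 'I_size2;
  relay1_measurable : forall v, measurable (relay1 @^-1` [set v]);
  relay2_measurable : forall v, measurable (relay2 @^-1` [set v]);
  decoder : 'I_size1 -> 'I_size2 -> 'I_N
}.

Arguments decoder {R1 R2 N n} d _ _.

Definition satisfies_power (P : R) R1 R2 N n
    (c : diamond_code R1 R2 N n) : Prop :=
  forall m : 'I_N, n%:R^-1 * \sum_(i < n) tnth (encoder c m) i ^+ 2 <= P.

Definition relay_observation n (gain : R) (x z : n.-tuple R) : n.-tuple R :=
  [tuple gain * tnth x i + tnth z i | i < n].

Definition decoded (alpha beta : R) R1 R2 N n (c : diamond_code R1 R2 N n)
    (m : 'I_N) (z : n.-tuple R) : 'I_N :=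
  decoder c (relay1 c (relay_observation alpha (encoder c m) z))
            (relay2 c (relay_observation beta (encoder c m) z)).

(* The uniform law on {0, .., N-1}, carried by nat because 'I_N is not pointed,
   hence not a measurableType, when N = 0. *)
Definition uniform_message (N : nat) : {measure set nat -> \bar R} :=
  mscale (N%:R^-1)%:nng (msum (fun k => \d_k) N).

Definition noise (n : nat) : probability (n.-tuple (measurableTypeR R)) R :=
  iid (normal_prob (0 : R) 1) n.

(* Under the product law the message mz.1 and the noise mz.2 are independent;
   the same noise reaches both relays. *)
Definition error_probability (alpha beta : R) R1 R2 N n
    (c : diamond_code R1 R2 N n) : \bar R :=
  (uniform_message N \x noise n)%E
    [set mz : nat * n.-tuple (measurableTypeR R) |
      exists2 m : 'I_N, mz.1 = m & decoded alpha beta c m mz.2 <> m].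

Lemma error_probabilityE (alpha beta : R) R1 R2 N n
    (c : diamond_code R1 R2 N n) :
  error_probability alpha beta c =
  ((N%:R^-1)%:E * \sum_(m < N)
     noise n [set z | decoded alpha beta c m z <> m])%E.
Proof.
rewrite /error_probability /product_measure1 /uniform_message.
set E := [set _ | _].
rewrite ge0_integral_mscale//= ge0_integral_measure_sum//=.
congr (_ * _)%E; apply: eq_bigr => m _.
rewrite integral_dirac//= diracT mul1e; congr (noise n _).
apply/seteqP; split=> z /=; rewrite /xsection/= inE /E/=.
- by move=> [m' /val_inj ->].
- by move=> zm; exists m.
Qed.

End diamond.

(* Main.v *)
Require Import Defs.
From mathcomp Require Import all_boot all_order all_algebra.
From mathcomp Require Import all_classical all_reals all_analysis.
From mathcomp Require Import ring.

(** Send [x(m) = delta * m] with [delta > 0] small, and put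
    [eta = (alpha - beta) * delta], which is nonzero. The common noise cancels
    in [Y1 - Y2 = eta * m], so [floor (Y1 / eta) = floor (Y2 / eta) + m]
    holds surely. Each relay forwards [floor (Yj / eta)] modulo [N], and the
    receiver recovers [m] as the difference of the two residues modulo [N]. *)

Import Order.TTheory GRing.Theory Num.Theory.

Local Open Scope ring_scope.

(** The remainder lies in [[0, k.+1)], so the absolute value changes nothing and [inord] never falls
    back to its default. *)
Definition residue (k : nat) (z : int) : 'I_k.+1 := inord `|(z %% k.+1)%Z|.

Lemma residueE k z : (residue k z : int) = (z %% k.+1)%Z.
Proof.
have zk0 : (0 <= z %% k.+1)%Z by exact: modz_ge0.
rewrite inordK ?gez0_abs// -ltz_nat gez0_abs//.
exact: ltz_pmod.
Qed.

(** The decoder sees only residues; this lets it recover the difference of the original integers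
    modulo [k.+1]. *)
Lemma residueB k (z w : int) :
  residue k (Posz (residue k z) - Posz (residue k w)) = residue k (z - w).
Proof.
apply: val_inj; apply/eqP; rewrite -eqz_nat !residueE.
by rewrite modzDml -modzDmr modzNm modzDmr.
Qed.

Lemma residue_ord k (m : 'I_k.+1) : residue k (m : nat) = m.
Proof.
apply: val_inj; apply/eqP; rewrite -eqz_nat residueE modz_small//=.
by rewrite ltz_nat ltn_ord.
Qed.

(** The integers are countable, and each fibre of the floor is a half-open interval. *)
Lemma measurable_floor_preimage (R : realType) (A : set int) :
  measurable ((fun x : R => Num.floor x) @^-1` A)%classic.
Proof.
rewrite [X in measurable X](_ : _ =
    \bigcup_(n : int) [set x : R | A n /\ Num.floor x = n])%classic; last first.
  apply/seteqP; split=> [x Ax|x [n _ /= [An xn]]] /=; last by rewrite xn.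
  by exists (Num.floor x).
apply: countable_bigcupT_measurable => // n.
have [An|nAn] := pselect (A n); last first.
  by rewrite [X in measurable X](_ : _ = set0)%classic// -subset0 => x [].
rewrite [X in measurable X](_ : _ = `[n%:~R, (n + 1)%:~R[)%classic//.
apply/seteqP; split=> x /=; rewrite in_itv/= -floor_eq.
- by move=> [_ ->].
- by move/eqP.
Qed.

Definition quantizer (R : realType) k (eta : R)
    (y : 1.-tuple (measurableTypeR R)) : 'I_k.+1 :=
  residue k (Num.floor (tnth y ord0 / eta)).

Lemma measurable_quantizer (R : realType) k (eta : R) (A : set 'I_k.+1) :
  measurable (quantizer R k eta @^-1` A)%classic.
Proof.
have mscaled : measurable_fun [set: 1.-tuple (measurableTypeR R)]
    (fun y => tnth y ord0 / eta : measurableTypeR R).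
  apply: measurable_realfun.measurable_funM => //; exact: measurable_tnth.
have := mscaled measurableT _ (measurable_floor_preimage R (residue k @^-1` A)%classic).
by rewrite setTI.
Qed.

(** The noise term cancels between the two quotients, leaving exactly [m], and an integer shift
    passes through the floor. *)
Lemma floor_offset (R : realType) (alpha beta delta z : R) (m : nat) :
  (alpha - beta) * delta != 0 ->
  Num.floor ((alpha * (delta * m%:R) + z) / ((alpha - beta) * delta)) =
  Num.floor ((beta * (delta * m%:R) + z) / ((alpha - beta) * delta)) + m.
Proof.
rewrite mulf_eq0 negb_or => /andP[ab0 d0].
rewrite (_ : _ / _ =
  (beta * (delta * m%:R) + z) / ((alpha - beta) * delta) + m%:R).
  by rewrite floorDrz ?natr_int// -[m%:R]/(m%:~R) intrKfloor.
by field; rewrite ab0 d0.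
Qed.

Lemma exists_zero_error_code (R : realType) (alpha beta R1 R2 P : R) (N : nat) :
  alpha != beta -> 0 < P -> (0 < N)%N ->
  N%:R <= 2 `^ R1 -> N%:R <= 2 `^ R2 ->
  exists c : diamond_code R1 R2 N 1,
    satisfies_power P c /\ error_probability alpha beta c = 0%E.
Proof.
case: N => // k ab P0 _ kR1 kR2.
(* This scale keeps every input [delta * m] with [m < k.+1] below [Num.sqrt P], and it is positive,
   so that [eta] is nonzero. *)
pose delta := Num.sqrt P / k.+1%:R.
pose eta := (alpha - beta) * delta.
have k0 : 0 < k.+1%:R :> R by rewrite ltr0n.
have eta0 : eta != 0 by rewrite mulf_neq0 ?subr_eq0// gt_eqF// divr_gt0 ?sqrtr_gt0.
have size1P : k.+1%:R <= 2 `^ (1%:R * R1) by rewrite mul1r.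
have size2P : k.+1%:R <= 2 `^ (1%:R * R2) by rewrite mul1r.
pose q := quantizer R k eta.
have mq v : measurable (q @^-1` [set v])%classic by exact: measurable_quantizer.
exists (DiamondCode size1P size2P
  (fun m : 'I_k.+1 => [tuple delta * (m : nat)%:R | i < 1]) mq mq
  (fun v w => residue k (Posz v - Posz w))).
split=> [m /=|].
(* The power of message [m] is [P * (m / k.+1) ^+ 2]. *)
- rewrite big_ord1 tnth_mktuple invr1 mul1r /delta mulrAC -mulrA exprMn.
  rewrite sqr_sqrtr ?(ltW P0)// ler_piMr ?(ltW P0)//.
  rewrite expr_le1// ?divr_ge0// ler_pdivrMr// mul1r ler_nat.
  exact: ltnW.
(* Decoding succeeds for every noise value, so the error event is empty rather than merely null. *)
- rewrite /error_probability [X in (_ \x _)%E X](_ : _ = set0)%classic ?measure0//.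
  rewrite -subset0 => -[n z] /= [m _]; apply.
  rewrite /decoded /= /q /quantizer !tnth_mktuple residueB floor_offset//.
  by rewrite addrAC subrr add0r residue_ord.
Qed.

Theorem proposition3 (R : realType) (alpha beta R1 R2 P : R)
    (hab : alpha <> beta) (hR1 : 0 < R1) (hR2 : 0 < R2) (hP : 0 < P) :
  exists c : diamond_code R1 R2 (Num.truncn (2 `^ Num.min R1 R2)) 1,
    satisfies_power P c /\ error_probability alpha beta c = 0%E.
Proof.
have le12 : 1 <= 2 :> R by rewrite ler1n.
have N_le : (Num.truncn (2 `^ Num.min R1 R2))%:R <= 2 `^ Num.min R1 R2 :> R.
  by rewrite truncn_le powR_ge0.
apply: exists_zero_error_code => //.
- exact/eqP.
(* The exponent is nonnegative, so the power of 2 is at least 1 and its integer part is positive. *)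
- by rewrite truncn_gt0 -[leLHS](powRr0 2) ler_powR// le_min !ltW.
- by apply: (le_trans N_le); rewrite ler_powR// ge_min lexx.
- by apply: (le_trans N_le); rewrite ler_powR// ge_min lexx orbT.
Qed.
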